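(* Let $q$ be a power of a prime $p$ and let $k$ and $l$ be positive integers such that $q\ge 4$ and $2\le k\le q-l-1$. Let $a_1,\ldots,a_l$ be $l$ distinct elements of $\mathbf{F}_q$ and let $D=\mathbf{F}_q\setminus\{a_1,\ldots,a_l\}$. Let $j$ be an integer with $1\le j\le l$ and let $u_j(x):=\lambda_j(x-a_j)^{q-2}+\nu_j x^{k-1}+f^{(j)}_{\le k-2}(x)$, where $\lambda_j\in\mathbf{F}_q^*$, $\nu_j\in\mathbf{F}_q$ and $f^{(j)}_{\le k-2}(x)\in\mathbf{F}_q[x]$ is a polynomial of degree at most $k-2$. Then the received word $(u_j(D),c_{k-1}(u_j(x)))\in\mathbf{F}_q^{q-l+1}$ is a deep hole of the generalized projective Reed-Solomon code ${\rm GPRS}_q(D,k)$ if and only if the sum $$\binom{q-2}{k-1}a_j^{q-1-k}\prod_{y\in I}(y-a_j)+e$$ is nonzero for every subset $I\subseteq D$ with $\#(I)=k$, where $e$ is the identity of the multiplicative group $\mathbf{F}_q^*$. Further, if $k\equiv 0\pmod p$, then the received word $(u_j(D),c_{k-1}(u_j(x)))$ is a deep hole of ${\rm GPRS}_q(D,k)$.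
   Context: $\mathbf{F}_q$ is the finite field with $q$ elements, of characteristic $p$; $\mathbf{F}_q^*$ is its group of nonzero elements. Polynomials ''of degree at most $m$'' include the zero polynomial. Write $D=\{y_1,\ldots,y_{q-l}\}$. For $f(x)\in\mathbf{F}_q[x]$, put $f(D):=(f(y_1),\ldots,f(y_{q-l}))$ and let $c_{k-1}(f(x))$ be the coefficient of $x^{k-1}$ in $f(x)$. The generalized projective Reed-Solomon code is ${\rm GPRS}_q(D,k):=\{(f(D),c_{k-1}(f(x)))\in\mathbf{F}_q^{q-l+1} : f(x)\in\mathbf{F}_q[x],\ \deg f(x)\le k-1\}$. For a code $C\subseteq \mathbf{F}_q^{N}$, $d(\cdot,\cdot)$ denotes Hamming distance (the number of coordinates in which two words differ), $d(w,C):=\min_{v\in C} d(w,v)$ is the error distance of $w\in\mathbf{F}_q^N$, and $\rho(C):=\max\{d(w,C): w\in\mathbf{F}_q^N\}$ is the covering radius. A word $w\in\mathbf{F}_q^{N}\setminus C$ is a deep hole of $C$ if $d(w,C)=\rho(C)$. The integer $\binom{q-2}{k-1}$ is interpreted in $\mathbf{F}_q$. *)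

(* Defs.v *)
From HB Require Import structures.
From mathcomp Require Import all_boot all_order all_algebra.

Set Implicit Arguments.
Unset Strict Implicit.
Unset Printing Implicit Defensive.

Import GRing.Theory.
Local Open Scope ring_scope.

Definition hamming_dist (F : finFieldType) (N : nat) (v w : 'rV[F]_N) : nat :=
  #|[set i | v 0 i != w 0 i]|.

(* The default value N of the iterated minimum bounds every Hamming distance,
   so for a nonempty code this is the minimum over the code. *)
Definition error_dist (F : finFieldType) (N : nat)
    (w : 'rV[F]_N) (C : {set 'rV[F]_N}) : nat :=
  \big[minn/N]_(v in C) hamming_dist w v.

Definition covering_radius (F : finFieldType) (N : nat)
    (C : {set 'rV[F]_N}) : nat :=
  \max_(w : 'rV[F]_N) error_dist w C.

Definition deep_hole (F : finFieldType) (N : nat)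
    (C : {set 'rV[F]_N}) (w : 'rV[F]_N) : Prop :=
  w \notin C /\ error_dist w C = covering_radius C.

Definition gprs_word (F : finFieldType) (n : nat) (y : 'I_n -> F) (k : nat)
    (f : {poly F}) : 'rV[F]_(n + 1) :=
  row_mx (\row_(i < n) f.[y i]) (const_mx f`_(k - 1)).

(* {poly_k F} is the finite type of polynomials p with size p <= k, that is,
   of degree at most k - 1 (zero included). *)
Definition gprs (F : finFieldType) (n : nat) (y : 'I_n -> F) (k : nat) :
    {set 'rV[F]_(n + 1)} :=
  [set gprs_word y k (val f) | f : {poly_k F}].

(* Main.v *)
Require Import Defs.
From HB Require Import structures.
From mathcomp Require Import all_boot all_order all_algebra finfield zify ring.

Set Implicit Arguments.
Unset Strict Implicit.
Unset Printing Implicit Defensive.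

Import GRing.Theory.
Local Open Scope ring_scope.

(** The code is MDS of length n + 1 and dimension k, where n = q - l: a codeword
    may be prescribed at any k of the n evaluation points, so every word lies at
    distance at most n + 1 - k from the code.

    For the words studied here, (x - a)^(q-2) takes the value 1/(x - a) at every
    x <> a, and a = a_j is not an evaluation point. Such a word is thus
    lambda/(y_i - a) + h(y_i) at the point y_i, with h of degree at most k - 1,
    followed by some last coordinate c; call it a pole word. The codeword of f
    agrees with it at y_i exactly when y_i is a root of
    P(x) = lambda + (x - a)(h - f)(x). Since P(a) = lambda <> 0 and deg P <= k,
    there are at most k agreements at evaluation points
    ([card_pole_roots]). The distance therefore drops below n + 1 - k only when
    some f produces k such agreements and also agrees at the last coordinate.
    In that case P = d * prod_(z in I) (x - z), where I is the set of the k
    roots and d is the coefficient of x^(k-1) in h - f, that is, h_(k-1) - c.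
    Evaluating at a gives d * prod_(z in I) (a - z) = lambda ([pole_roots_maximal]), and
    conversely any I of size k satisfying this equation yields an f
    ([pole_roots_exist]). This is [error_dist_pole_word].

    Applied to the pole word with lambda = 1, h = 0 and c = 0, the equation
    would read 0 = 1, so the bound n + 1 - k is attained and is the covering
    radius. Applied to the given word, d = - lambda 'C(q-2, k-1) (-a)^(q-1-k), and the signs
    cancel because (-1)^(q-1) = 1 in F; this is the stated criterion. If p
    divides k, then k 'C(q-1, k) = (q-1) 'C(q-2, k-1) makes the binomial vanish
    in F, and the criterion reduces to 1 <> 0. *)

(** * Distances and the upper bound on the covering radius *)

Lemma hamming_dist_agree (F : finFieldType) (N : nat) (v w : 'rV[F]_N) :
  (hamming_dist v w + #|[set i | (v 0 i == w 0 i)%R]| = N)%N.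
Proof.
rewrite -[RHS]card_ord -(cardsC [set i | v 0 i != w 0 i]).
by congr (_ + _)%N; apply: eq_card => i; rewrite !inE negbK.
Qed.

(** Separates the coordinate at infinity from the evaluation points. *)
Lemma hamming_dist_row_mx (F : finFieldType) (n : nat) (v w : 'rV[F]_n)
    (c d : F) :
  hamming_dist (row_mx v (const_mx c)) (row_mx w (const_mx d) : 'rV_(n + 1))
    = (hamming_dist v w + (c != d))%N.
Proof.
rewrite /hamming_dist -!sum1dep_card !big_mkcond big_split_ord big_ord1 /=.
rewrite !row_mxEr !mxE [in RHS]big_mkcond; congr addn.
by apply: eq_bigr => i _; rewrite !row_mxEl.
Qed.

Lemma leq_error_dist (F : finFieldType) (n : nat) (y : 'I_n -> F) (k d : nat)
    (w : 'rV[F]_(n + 1)) : (d <= n + 1)%N ->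
  (d <= error_dist w (gprs y k))%N <->
  (forall f : {poly F},
     (size f <= k)%N -> (d <= hamming_dist w (gprs_word y k f))%N).
Proof.
move=> le_dn; rewrite /error_dist -Order.NatOrder.minEnat -Order.NatOrder.leEnat.
split=> [/Order.TotalTheory.bigmin_geP[_ le_d] f size_f | le_d].
  by apply: le_d; apply/imsetP; exists (NPoly size_f).
apply/Order.TotalTheory.bigmin_geP; split=> // _ /imsetP[f _ ->].
exact/le_d/size_npoly.
Qed.

Lemma interpolation (F : fieldType) (T : eqType) (e v : T -> F) (s : seq T) :
    injective e -> uniq s ->
  exists2 f : {poly F}, (size f <= size s)%N & {in s, forall i, f.[e i] = v i}.
Proof.
move=> e_inj; elim: s => [_ | i s IHs /= /andP[s'i /IHs[f size_f fE]]].
  by exists 0; rewrite ?size_poly0.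
pose P : {poly F} := \prod_(z <- s) ('X - (e z)%:P).
have P_root z : (P.[e z] == 0) = (z \in s).
  rewrite /P -(big_map e xpredT (fun x => 'X - x%:P)) -rootE root_prod_XsubC.
  by rewrite mem_map.
exists (f + ((v i - f.[e i]) / P.[e i]) *: P).
  apply: leq_trans (size_polyD _ _) _; rewrite geq_max (leq_trans size_f) //=.
  by apply: leq_trans (size_scale_leq _ _) _; rewrite size_prod_XsubC.
move=> z; rewrite inE hornerD hornerZ => /predU1P[-> | sz].
  by rewrite divfK ?P_root // addrC subrK.
by move: sz (fE z sz); rewrite -P_root => /eqP-> ->; rewrite mulr0 addr0.
Qed.

(** Interpolating the word at the first k evaluation points already gives a
    codeword with k agreements; the last coordinate is left to chance. *)
Lemma error_dist_gprs_le (F : finFieldType) (n : nat) (y : 'I_n -> F) (k : nat)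
    (w : 'rV[F]_(n + 1)) :
  injective y -> (k <= n)%N -> (error_dist w (gprs y k) <= n + 1 - k)%N.
Proof.
move=> y_inj le_kn; rewrite -[w]hsubmxK.
have -> : rsubmx w = const_mx (rsubmx w 0 0).
  by apply/matrixP => i j; rewrite !ord1 !mxE.
set v := lsubmx w; set c := rsubmx w 0 0.
pose s := take k (enum 'I_n).
have size_s : size s = k by rewrite size_takel // size_enum_ord.
have uniq_s : uniq s by rewrite take_uniq ?enum_uniq.
have [f] := interpolation (v 0) y_inj uniq_s; rewrite size_s => size_f fE.
have le_e : (error_dist (row_mx v (const_mx c)) (gprs y k) <= n + 1)%N.
  rewrite /error_dist -Order.NatOrder.minEnat -Order.NatOrder.leEnat.
  exact: Order.TotalTheory.bigmin_le_id.
apply: leq_trans (iffLR (leq_error_dist y k _ le_e) (leqnn _) f size_f) _.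
rewrite hamming_dist_row_mx.
have : (hamming_dist v (\row_i f.[y i]) + k <= n)%N.
  rewrite -[leqRHS](hamming_dist_agree v (\row_i f.[y i])) leq_add2l -size_s.
  rewrite -(card_uniqP uniq_s); apply/subset_leq_card/subsetP=> i si.
  by rewrite inE [eqbRHS]mxE fE.
rewrite leq_subRL ?(leq_trans le_kn) ?leq_addr // addnA [(k + _)%N]addnC => le_n.
by rewrite leq_add ?leq_b1.
Qed.

(** * Polynomials taking a prescribed nonzero value at the pole *)

Lemma coef_mulXsubC_top (R : nzRingType) (h : {poly R}) (a : R) (k : nat) :
  (0 < k)%N -> (size h <= k)%N -> (h * ('X - a%:P))`_k = h`_(k - 1).
Proof.
move=> k_gt0 size_h; rewrite mulrBr coefB coefMX coefMC [h`_k]nth_default //.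
by rewrite mul0r subr0 gtn_eqF // subn1.
Qed.

Lemma size_prod_XsubC_set (F : finFieldType) (I : {set F}) :
  size (\prod_(z in I) ('X - z%:P)) = #|I|.+1.
Proof. by rewrite -big_enum size_prod_XsubC -cardE. Qed.

Lemma horner_prod_XsubC_set (F : finFieldType) (I : {set F}) (x : F) :
  (\prod_(z in I) ('X - z%:P)).[x] = \prod_(z in I) (x - z).
Proof. by rewrite horner_prod; apply: eq_bigr => z _; rewrite hornerXsubC. Qed.

Lemma coef_prod_XsubC_set_card (F : finFieldType) (I : {set F}) :
  (\prod_(z in I) ('X - z%:P))`_#|I| = 1.
Proof.
have /monicP := monic_prod_XsubC (enum I) xpredT (fun z : F => z).
by rewrite lead_coefE -big_enum size_prod_XsubC -cardE.
Qed.

Lemma size_linear_mul (F : fieldType) (h : {poly F}) (a lambda : F) (k : nat) :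
  (size h <= k)%N -> (size (lambda%:P + h * ('X - a%:P))%R <= k.+1)%N.
Proof.
move=> size_h; apply: leq_trans (size_polyD _ _) _.
rewrite geq_max (leq_trans (size_polyC_leq1 _)) //=.
by apply: leq_trans (size_polyMleq _ _) _; rewrite size_XsubC addn2.
Qed.

Lemma horner_linear_mul (R : comNzRingType) (h : {poly R}) (a lambda z : R) :
  (lambda%:P + h * ('X - a%:P)).[z] = lambda + h.[z] * (z - a).
Proof. by rewrite hornerD hornerM hornerC hornerXsubC. Qed.

(** The polynomial lambda + (x - a) h has degree at most k, and is nonzero
    because its value at a is lambda. *)
Lemma card_pole_roots (F : finFieldType) (a lambda : F) (h : {poly F})
    (k : nat) (J : {set F}) :
    lambda != 0 -> (size h <= k)%N ->
    {in J, forall z, lambda + h.[z] * (z - a) = 0} ->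
  (#|J| <= k)%N.
Proof.
move=> lambda0 size_h J0; pose P := lambda%:P + h * ('X - a%:P).
have PE := horner_linear_mul h a lambda : forall z, P.[z] = _.
have P0 : P != 0.
  apply: contra_neq lambda0 => P0.
  by have := PE a; rewrite P0 horner0 subrr mulr0 addr0.
rewrite -ltnS; apply: leq_trans (size_linear_mul a lambda size_h).
rewrite cardE; apply: max_poly_roots P0 _ (enum_uniq J).
by apply/allP => z; rewrite mem_enum => /J0 Jz; rewrite rootE PE Jz.
Qed.

(** With k roots, lambda + (x - a) h is its coefficient of x^k times the monic
    polynomial vanishing on J; both sides are compared at a. *)
Lemma pole_roots_maximal (F : finFieldType) (a lambda : F) (h : {poly F})
    (k : nat) (J : {set F}) :
    (0 < k)%N -> (size h <= k)%N -> #|J| = k ->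
    {in J, forall z, lambda + h.[z] * (z - a) = 0} ->
  h`_(k - 1) * \prod_(z in J) (a - z) = lambda.
Proof.
move=> k_gt0 size_h card_J J0.
pose P := lambda%:P + h * ('X - a%:P).
have PE := horner_linear_mul h a lambda : forall z, P.[z] = _.
pose Q := P - h`_(k - 1) *: \prod_(z in J) ('X - z%:P).
have QE z : Q.[z] = P.[z] - h`_(k - 1) * \prod_(t in J) (z - t).
  by rewrite /Q hornerD hornerN hornerZ horner_prod_XsubC_set.
have size_Q : (size Q <= k)%N.
  (* Q has degree at most k, and its coefficients of x^k cancel. *)
  have size_Q : (size Q <= k.+1)%N.
    rewrite (leq_trans (size_polyD _ _)) // geq_max size_linear_mul // size_polyN.
    by rewrite (leq_trans (size_scale_leq _ _)) // size_prod_XsubC_set card_J.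
  apply/leq_sizeP => i; rewrite leq_eqVlt => /predU1P[<- | lt_ki]; last first.
    exact: (leq_sizeP _ _ size_Q).
  rewrite coefB coefZ coefD coefC gtn_eqF // add0r coef_mulXsubC_top //.
  by have := coef_prod_XsubC_set_card J; rewrite card_J => ->; rewrite mulr1 subrr.
have Q0 : Q = 0.
  apply: contraTeq size_Q => Q0; rewrite -ltnNge -card_J cardE.
  apply: max_poly_roots Q0 _ (enum_uniq J); apply/allP => z.
  rewrite mem_enum => Jz; rewrite rootE QE PE J0 // sub0r oppr_eq0 mulf_eq0.
  by rewrite (big_setD1 z) //= subrr mul0r eqxx orbT.
have := QE a; rewrite Q0 horner0 PE subrr mulr0 addr0 => /esym/eqP.
by rewrite subr_eq0 => /eqP/esym.
Qed.

(** Converse of [pole_roots_maximal]: c * prod_(z in I) (x - z) takes the value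
    lambda at a, so subtracting lambda leaves a multiple of x - a. *)
Lemma pole_roots_exist (F : finFieldType) (a lambda c : F) (I : {set F}) :
    (0 < #|I|)%N -> c * \prod_(z in I) (a - z) = lambda ->
  exists h : {poly F},
    [/\ (size h <= #|I|)%N, h`_(#|I| - 1) = c
      & {in I, forall z, lambda + h.[z] * (z - a) = 0}].
Proof.
move=> I_gt0 c_lambda; pose P := c *: \prod_(z in I) ('X - z%:P).
have PE z : P.[z] = c * \prod_(t in I) (z - t).
  by rewrite /P hornerZ horner_prod_XsubC_set.
have /factor_theorem[h hE] : root (P - lambda%:P) a.
  by rewrite rootE hornerD hornerN hornerC PE c_lambda subrr.
have size_h : (size h <= #|I|)%N.
  have [-> | h0] := eqVneq h 0; first by rewrite size_poly0.
  have := size_Mmonic h0 (monicXsubC a).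
  rewrite size_XsubC addn2 -hE -ltnS /= => <-.
  rewrite (leq_trans (size_polyD _ _)) // geq_max size_polyN.
  rewrite (leq_trans (size_polyC_leq1 _)) // andbT.
  by rewrite (leq_trans (size_scale_leq _ _)) // size_prod_XsubC_set.
exists h; split=> // [|z Iz].
  rewrite -(coef_mulXsubC_top a I_gt0 size_h) -hE coefB coefC gtn_eqF // subr0.
  by rewrite coefZ coef_prod_XsubC_set_card mulr1.
rewrite -[z - a]hornerXsubC -hornerM -hE hornerD hornerN hornerC PE.
by rewrite (big_setD1 z) //= subrr mul0r mulr0 add0r subrr.
Qed.

(** * The error distance of a word with a simple pole off the evaluation set *)

Definition pole_word (F : finFieldType) (n : nat) (y : 'I_n -> F)
    (a lambda : F) (h : {poly F}) (c : F) : 'rV[F]_(n + 1) :=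
  row_mx (\row_(i < n) (lambda / (y i - a) + h.[y i])) (const_mx c).

Lemma pole_agreeE (F : fieldType) (a lambda x : F) (h f : {poly F}) :
  x != a ->
  (lambda / (x - a) + h.[x] == f.[x]) = (lambda + (h - f).[x] * (x - a) == 0).
Proof.
rewrite -subr_eq0 => xa0; rewrite -subr_eq0 -addrA -hornerN -hornerD.
by rewrite -(inj_eq (mulIf xa0)) mul0r mulrDl divfK.
Qed.

(** A codeword closer than n + 1 - k has k + 1 agreements. At most k of them are
    at evaluation points, so they are exactly k evaluation points together with
    the last coordinate, which fixes the leading coefficient in
    [pole_roots_maximal]. *)
Lemma error_dist_pole_word (F : finFieldType) (n : nat) (y : 'I_n -> F)
    (k : nat) (a lambda : F) (h : {poly F}) (c : F) :
    injective y -> (0 < k <= n)%N -> (forall i, y i != a) -> lambda != 0 ->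
    (size h <= k)%N ->
  error_dist (pole_word y a lambda h c) (gprs y k) = (n + 1 - k)%N <->
  (forall I : {set F}, I \subset [set y i | i : 'I_n] -> #|I| = k ->
     (c - h`_(k - 1)) * \prod_(z in I) (a - z) + lambda != 0).
Proof.
move=> y_inj /andP[k_gt0 le_kn] ya lambda0 size_h.
pose agree f := [set i | lambda / (y i - a) + h.[y i] == f.[y i]].
have distE f : (hamming_dist (pole_word y a lambda h c) (gprs_word y k f)
    + #|agree f| = n + (c != f`_(k - 1))%R)%N.
  rewrite hamming_dist_row_mx addnAC; congr addn.
  rewrite -[RHS](hamming_dist_agree (\row_i (lambda / (y i - a) + h.[y i]))
                                   (\row_i f.[y i])).
  by congr addn; apply: eq_card => i; rewrite !inE !mxE.
have -> : (error_dist (pole_word y a lambda h c) (gprs y k) = n + 1 - k)%N <->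
    (n + 1 - k <= error_dist (pole_word y a lambda h c) (gprs y k))%N.
  split=> [-> // | le_e]; apply/eqP.
  by rewrite eqn_leq le_e error_dist_gprs_le.
rewrite leq_error_dist ?leq_subr //; split=> [far I sID card_I | noI f size_f].
  apply/negP; rewrite addr_eq0 => /eqP eqI.
  have I_gt0 : (0 < #|I|)%N by rewrite card_I.
  (* r is the difference h - f for the codeword f to be found, so its top
     coefficient must be h`_(k - 1) - c for f to agree at infinity. *)
  have /(pole_roots_exist I_gt0)[r] :
      (h`_(k - 1) - c) * \prod_(z in I) (a - z) = lambda.
    by rewrite -opprB mulNr eqI opprK.
  rewrite card_I => -[size_r coef_r r0].
  have size_f : (size (h - r)%R <= k)%N.
    by rewrite (leq_trans (size_polyD _ _)) // geq_max size_polyN size_h.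
  have := far _ size_f; rewrite leqNgt => /negP; apply.
  have := distE (h - r); rewrite coefB coef_r subKr eqxx addn0.
  have : (k <= #|agree (h - r)%R|)%N.
    rewrite -card_I -(card_imset _ y_inj) subset_leq_card //.
    apply/subsetP => z Iz; have /imsetP[i _ zE] := subsetP sID z Iz.
    by rewrite zE imset_f // inE pole_agreeE // subKr -zE r0.
  by lia.
pose J := y @: agree f.
have card_J : #|J| = #|agree f| by rewrite card_imset.
have size_hf : (size (h - f)%R <= k)%N.
  by rewrite (leq_trans (size_polyD _ _)) // geq_max size_polyN size_h.
have J0 : {in J, forall z, lambda + (h - f).[z] * (z - a) = 0}.
  by move=> _ /imsetP[i + ->]; rewrite inE pole_agreeE // => /eqP.
have le_Jk := card_pole_roots lambda0 size_hf J0.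
suff : (#|agree f| + (c == f`_(k - 1))%R <= k)%N.
  have := distE f; case: (c == _) => /=; lia.
rewrite -card_J; move: le_Jk; rewrite leq_eqVlt => /predU1P[Jk | lt_Jk]; last first.
  by rewrite (leq_trans (leq_add (leqnn _) (leq_b1 _))) ?addn1.
have := pole_roots_maximal k_gt0 size_hf Jk J0.
have sJ : J \subset [set y i | i : 'I_n].
  by apply/subsetP => _ /imsetP[i _ ->]; rewrite imset_f.
have [cf | _] := eqVneq c f`_(k - 1); last by rewrite Jk addn0.
move=> eqJ; have := noI J sJ Jk.
by rewrite -eqJ coefB cf -mulrDl addrC subrKA subrr mul0r eqxx.
Qed.

(** * Arithmetic in the finite field *)

Lemma coef_XsubC_exp (R : comNzRingType) (a : R) (n i : nat) :
  (('X - a%:P) ^+ n)`_i = 'C(n, i)%:R * (- a) ^+ (n - i).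
Proof.
have -> : ('X - a%:P) ^+ n = \poly_(j < n.+1) ('C(n, j)%:R * (- a) ^+ (n - j)).
  rewrite addrC -polyCN exprDn poly_def; apply: eq_bigr => j _.
  by rewrite -polyC_exp mul_polyC -scaler_nat scalerA.
by rewrite coef_poly; case: ltnP => // lt_ni; rewrite bin_small // mul0r.
Qed.

Lemma expf_card_sub2 (F : finFieldType) (x : F) :
  x != 0 -> x ^+ (#|F| - 2) = x^-1.
Proof.
move=> x0; apply: (mulfI x0); rewrite divff //; apply: (mulfI x0).
rewrite mulr1 -!exprS subnSK ?finNzRing_gt1 // subn1 prednK ?expf_card //.
by rewrite ltnW ?finNzRing_gt1.
Qed.

(** Translation by 1 permutes R, so it leaves the sum of all elements fixed,
    while it adds 1 to each of the #|R| terms. *)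
Lemma natr_card (R : finNzRingType) : #|R|%:R = 0 :> R.
Proof.
apply: (addrI (\sum_(x : R) x)).
by rewrite addr0 [RHS](reindex_inj (addIr 1)) big_split /= sumr_const.
Qed.

(** Read k 'C(q-1, k) = (q-1) 'C(q-2, k-1) in F, where k = 0 and q - 1 = -1. *)
Lemma bin_card_sub2_eq0 (F : finFieldType) (p k : nat) :
  p \in [pchar F] -> (0 < k)%N -> (p %| k)%N ->
  'C(#|F| - 2, k - 1)%:R = 0 :> F.
Proof.
move=> pF k_gt0 pk; have q_gt1 := finNzRing_gt1 F.
have /(congr1 (fun m => m%:R : F)) := mul_bin_diag (#|F| - 1) (k - 1).
rewrite !subn1 prednK // !natrM (_ : k%:R = 0); last first.
  by apply/eqP; rewrite -(dvdn_pcharf pF).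
have -> : (#|F|.-1)%:R = -1 :> F.
  apply/eqP; rewrite -addr_eq0.
  by rewrite natr1 (prednK (ltnW q_gt1)) natr_card eqxx.
by move/eqP; rewrite mul0r mulN1r oppr_eq0 -subn2 => /eqP.
Qed.

(** * The deep hole criterion *)

Theorem theorem1p5 (p m q : nat) (hp : prime p) (hm : (0 < m)%N)
    (hq : q = (p ^ m)%N) (F : finFieldType) (hF : #|F| = q)
    (k l : nat) (hk0 : (0 < k)%N) (hl0 : (0 < l)%N) (hq4 : (4 <= q)%N)
    (hk : (2 <= k <= q - l - 1)%N)
    (a : 'I_l -> F) (ha : injective a)
    (D : {set F}) (hD : D = [set: F] :\: [set a i | i : 'I_l])
    (y : 'I_(q - l) -> F) (hy : injective y) (hyD : D = [set y i | i : 'I_(q - l)])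
    (j : 'I_l) (lambda nu : F) (hlambda : lambda != 0)
    (g : {poly F}) (hg : (size g <= k - 1)%N)
    (u : {poly F})
    (hu : u = lambda *: ('X - (a j)%:P) ^+ (q - 2) + nu *: 'X^(k - 1) + g) :
  (deep_hole (gprs y k) (gprs_word y k u) <->
     (forall I : {set F}, I \subset D -> #|I| = k ->
        ('C(q - 2, k - 1))%:R * a j ^+ (q - 1 - k) * (\prod_(z in I) (z - a j))
          + 1 != 0))
  /\ (k = 0 %[mod p] -> deep_hole (gprs y k) (gprs_word y k u)).
Proof.
have ya i : y i != a j.
  have : y i \in D by rewrite hyD imset_f.
  by rewrite hD !inE andbT; apply: contraNneq => ->; rewrite imset_f.
have [le2k le_k] := andP hk.
have k_bounds : (0 < k <= q - l)%N by rewrite hk0 (leq_trans le_k) ?leq_subr.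
have le_kn : (k <= q - l)%N by case/andP: k_bounds.
have radius : covering_radius (gprs y k) = (q - l + 1 - k)%N.
  apply/eqP; rewrite eqn_leq; apply/andP; split.
    by apply/bigmax_leqP => w _; exact: error_dist_gprs_le.
  (* 1/(x - a_j) with last coordinate 0 is at maximal distance. *)
  apply: (bigmax_sup (pole_word y (a j) 1 0 0)) => //.
  rewrite (iffRL (error_dist_pole_word 0 hy k_bounds ya (oner_neq0 F) _)) //.
    by rewrite size_poly0.
  by move=> I _ _; rewrite coef0 subrr mul0r add0r oner_neq0.
pose h := nu *: 'X^(k - 1) + g.
have size_h : (size h <= k)%N.
  rewrite (leq_trans (size_polyD _ _)) // geq_max (leq_trans hg) ?leq_subr //.
  by rewrite (leq_trans (size_scale_leq _ _)) // size_polyXn subn1 prednK.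
have wordE : gprs_word y k u = pole_word y (a j) lambda h u`_(k - 1).
  congr row_mx; apply/rowP => i; rewrite !mxE hu -addrA hornerD hornerZ.
  by rewrite horner_exp hornerXsubC -hF expf_card_sub2 // subr_eq0.
have deepE : deep_hole (gprs y k) (gprs_word y k u) <->
    error_dist (gprs_word y k u) (gprs y k) = (q - l + 1 - k)%N.
  rewrite /deep_hole radius; split=> [[] // | dE]; split=> //.
  apply/negP => /imsetP[f _ wE].
  have le_e : (q - l + 1 - k <= error_dist (gprs_word y k u) (gprs y k))%N.
    by rewrite dE.
  have := iffLR (leq_error_dist y k _ (leq_subr k _)) le_e _ (size_npoly f).
  rewrite wE leqNgt => /negP; apply.
  have -> : hamming_dist (gprs_word y k (val f)) (gprs_word y k (val f)) = 0%N.
    by apply: eq_card0 => i; rewrite !inE eqxx.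
  by rewrite subn_gt0 addn1 ltnS.
have sign : (-1) ^+ (q - 1) = 1 :> F.
  have -> : (q - 1 = (q - 2).+1)%N by lia.
  by rewrite -hF exprS expf_card_sub2 ?oppr_eq0 ?oner_neq0 // invrN1 mulrNN mulr1.
have condE (I : {set F}) : #|I| = k ->
    (u`_(k - 1) - h`_(k - 1)) * \prod_(z in I) (a j - z) + lambda =
    lambda * ('C(q - 2, k - 1)%:R * a j ^+ (q - 1 - k)
                * (\prod_(z in I) (z - a j)) + 1).
  move=> card_I.
  have -> : \prod_(z in I) (a j - z) = (-1) ^+ k * \prod_(z in I) (z - a j).
    by rewrite -card_I -prodrN; apply: eq_bigr => z _; rewrite opprB.
  rewrite hu -addrA coefD addrK coefZ coef_XsubC_exp.
  have -> : (q - 2 - (k - 1) = q - 1 - k)%N by lia.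
  have {}sign : (-1) ^+ (q - 1 - k) * (-1) ^+ k = 1 :> F.
    by rewrite -exprD subnK //; lia.
  rewrite [(- a j) ^+ _]exprNn mulrDr mulr1; congr (_ + _).
  move: sign; move: (\prod_(z in I) (z - a j)) ((-1) ^+ k) => P s.
  move: ((-1) ^+ (q - 1 - k)) 'C(q - 2, k - 1)%:R => t c ts.
  by rewrite -[RHS]mul1r -ts; ring.
have deep_iff : deep_hole (gprs y k) (gprs_word y k u) <->
    (forall I : {set F}, I \subset D -> #|I| = k ->
       'C(q - 2, k - 1)%:R * a j ^+ (q - 1 - k) * (\prod_(z in I) (z - a j))
         + 1 != 0).
  rewrite deepE wordE (error_dist_pole_word _ hy k_bounds ya hlambda size_h) -hyD.
  by split=> cond I sID card_I; have := cond I sID card_I;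
    rewrite condE // mulf_eq0 negb_or hlambda.
split=> // /eqP; rewrite mod0n -/(dvdn p k) => pk.
have pF := card_finPcharP (etrans hF hq) hp.
apply/deep_iff => I _ _.
by rewrite -hF (bin_card_sub2_eq0 pF hk0 pk) !mul0r add0r oner_neq0.
Qed.
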